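(* Let $\mathbf{A}$ and $\mathbf{B}$ be countable weakly oligomorphic relational structures over the same signature. The following are equivalent: (1) $\mathbf{A}$ and $\mathbf{B}$ are homomorphism-equivalent; (2) $\mathbf{A}$ and $\mathbf{B}$ have the same positive existential theory; (3) $\mathrm{Age}(\mathbf{A})\to\mathrm{Age}(\mathbf{B})$ and $\mathrm{Age}(\mathbf{B})\to\mathrm{Age}(\mathbf{A})$; (4) $\operatorname{CSP}(\mathbf{A})=\operatorname{CSP}(\mathbf{B})$, where $\operatorname{CSP}(\mathbf{X})$ is the class of finite structures $\mathbf{C}$ with a homomorphism $\mathbf{C}\to\mathbf{X}$.
   Context: Relational structures have signatures with only relation symbols (any cardinality); ''countable'' means finite or countably infinite. A positive existential type in $x_1,\dots,x_n$ is a set of positive existential formulas with free variables among $x_1,\dots,x_n$, defining the intersection of the relations defined by its members; a structure is weakly oligomorphic if for each $n$ only finitely many $n$-ary relations are definable by such types. Homomorphism-equivalent means homomorphisms exist in both directions. The positive existential theory of a structure is the set of positive existential sentences true in it. $\mathrm{Age}(\mathbf{A})$ is the class of finite structures embeddable into $\mathbf{A}$; for classes, $\mathcal{A}\to\mathcal{B}$ means every member of $\mathcal{A}$ has a homomorphism into some member of $\mathcal{B}$. *)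

(* Defs.v *)
From mathcomp Require Import all_boot.
From mathcomp Require Import classical_sets functions cardinality.

Set Implicit Arguments.
Unset Strict Implicit.
Unset Printing Implicit Defensive.

Local Open Scope classical_set_scope.

(** Symbols of arity 0 and structures with empty carrier are allowed. *)

Record signature := Signature { symbol : Type; arity : symbol -> nat }.

Record structure (S : signature) := Structure {
  carrier :> Type;
  rel_interp : forall r : symbol S, set ('I_(arity r) -> carrier) }.

Arguments rel_interp {S} s r _.

Section Morphisms.
Context {S : signature}.
Implicit Types A B C D : structure S.

Definition is_hom A B (f : A -> B) : Prop :=
  forall (r : symbol S) (x : 'I_(arity r) -> A),
    rel_interp A r x -> rel_interp B r (f \o x).

Definition is_embedding A B (f : A -> B) : Prop :=
  injective f /\
  forall (r : symbol S) (x : 'I_(arity r) -> A),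
    rel_interp A r x <-> rel_interp B r (f \o x).

Definition hom_to A B : Prop := exists f : A -> B, is_hom f.

Definition embeds_in A B : Prop := exists f : A -> B, is_embedding f.

Definition hom_equivalent A B : Prop := hom_to A B /\ hom_to B A.

Definition finite_structure A : Prop := finite_set [set: A].

Definition countable_structure A : Prop := countable [set: A].

Definition Age A : set (structure S) :=
  [set C | finite_structure C /\ embeds_in C A].

Definition CSP A : set (structure S) :=
  [set C | finite_structure C /\ hom_to C A].

Definition class_hom_to (K L : set (structure S)) : Prop :=
  forall C, K C -> exists D, L D /\ hom_to C D.

End Morphisms.

(** [pe_formula S n]: positive existential formulas with free variables among
    x_0, ..., x_(n-1).  In [PEex phi], the variable of index 0 of [phi] is the
    bound one, and the index [i.+1] refers to the outer variable [i]. *)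
Inductive pe_formula (S : signature) : nat -> Type :=
| PEtrue n : pe_formula S n
| PEfalse n : pe_formula S n
| PEeq n (i j : 'I_n) : pe_formula S n
| PErel n (r : symbol S) (v : 'I_(arity r) -> 'I_n) : pe_formula S n
| PEand n (phi psi : pe_formula S n) : pe_formula S n
| PEor n (phi psi : pe_formula S n) : pe_formula S n
| PEex n (phi : pe_formula S n.+1) : pe_formula S n.

Definition env_cons (T : Type) n (a : T) (e : 'I_n -> T) : 'I_n.+1 -> T :=
  fun i => oapp e a (unlift ord0 i).

Definition empty_env (T : Type) : 'I_0 -> T :=
  fun i => False_rect T (notF (ltn_ord i)).

Fixpoint sat (S : signature) (A : structure S) n (phi : pe_formula S n) :
    ('I_n -> A) -> Prop :=
  match phi in pe_formula _ m return ('I_m -> A) -> Prop with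
  | PEtrue _ => fun _ => True
  | PEfalse _ => fun _ => False
  | PEeq _ i j => fun e => e i = e j
  | PErel _ r v => fun e => rel_interp A r (e \o v)
  | PEand _ phi1 phi2 => fun e => sat phi1 e /\ sat phi2 e
  | PEor _ phi1 phi2 => fun e => sat phi1 e \/ sat phi2 e
  | PEex _ phi1 => fun e => exists a : A, sat phi1 (env_cons a e)
  end.

Section Definability.
Context {S : signature}.
Implicit Type A : structure S.

Definition pe_theory A : set (pe_formula S 0) :=
  [set phi | sat phi (@empty_env A)].

Definition type_relation A n (Phi : set (pe_formula S n)) : set ('I_n -> A) :=
  \bigcap_(phi in Phi) [set a | sat phi a].

Arguments type_relation A [n] Phi.

Definition weakly_oligomorphic A : Prop :=
  forall n, finite_set [set R | exists Phi : set (pe_formula S n),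
                                  R = type_relation A Phi].

End Definability.

(* Main.v *)
(** Homomorphisms between weakly oligomorphic countable structures are built by
    a back-and-forth argument without "back".  Over a weakly oligomorphic [B] a
    positive existential type closed under conjunction is equivalent to one of
    its members, so if the type of [a] in [A] is contained in the type of [b] in
    [B], then for every [a'] the existential closure of that member over the
    type of [a', a] yields [b'] with the type of [a', a] contained in that of
    [b', b].  Starting from the inclusion of the positive existential theories
    and exhausting the countable [A] gives a homomorphism.  Conversely, a true
    positive existential sentence is witnessed by finitely many elements, so the
    theory of [A] is controlled by the finite structures mapping to [A]. *)

Require Import Defs.
From mathcomp Require Import all_boot.
From mathcomp Require Import boolp classical_sets functions cardinality.

Set Implicit Arguments.
Unset Strict Implicit.
Unset Printing Implicit Defensive.

Local Open Scope classical_set_scope.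

Lemma comp_env_cons (T U : Type) (f : T -> U) n (a : T) (e : 'I_n -> T) :
  f \o env_cons a e = env_cons (f a) (f \o e).
Proof. by apply/funext => i; rewrite /env_cons /=; case: unliftP. Qed.

Lemma env_ord0 (T : Type) (e e' : 'I_0 -> T) : e = e'.
Proof. by apply/funext => -[]. Qed.

Section Homomorphisms.
Context {S : signature}.
Implicit Types A B C : structure S.

Definition is_hom_on A B (F : set A) (f : A -> B) : Prop :=
  forall (r : symbol S) (x : 'I_(arity r) -> A),
    (forall i, F (x i)) -> rel_interp A r x -> rel_interp B r (f \o x).

Lemma is_hom_on_subset A B (F G : set A) (f : A -> B) :
  F `<=` G -> is_hom_on G f -> is_hom_on F f.
Proof. by move=> FG hf r x Fx; apply: hf => i; apply: FG. Qed.

(** A true formula rests on finitely many relational atoms; [F] collects the entries of their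
    tuples. Equalities and witnesses are carried along by any function. *)
Lemma sat_hom_on_finite A n (phi : pe_formula S n) (e : 'I_n -> A) :
  sat phi e ->
  exists2 F : set A, finite_set F &
    forall B (f : A -> B), is_hom_on F f -> sat phi (f \o e).
Proof.
elim: phi e => {n} /=.
- by move=> n e _; exists set0.
- by [].
- by move=> n i j e eij; exists set0 => // B f _ /=; rewrite eij.
- move=> n r v e rev; exists (range (e \o v)).
    exact: finite_image.
  by move=> B f hf; apply: (hf r (e \o v)) => // i; exists i.
- move=> n phi IHphi psi IHpsi e [/IHphi[F finF satF] /IHpsi[G finG satG]].
  exists (F `|` G); first by rewrite finite_setU.
  by move=> B f hf; split; [apply: satF|apply: satG];
    apply: is_hom_on_subset hf => x; [left|right].
- by move=> n phi IHphi psi IHpsi e [/IHphi|/IHpsi] [F finF satF]; exists F => // B f hf;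
    [left|right]; apply: satF.
- move=> n phi IHphi e [a /IHphi[F finF satF]]; exists F => // B f hf.
  by exists (f a); rewrite -comp_env_cons; apply: satF.
Qed.

Lemma sat_hom A B (f : A -> B) n (phi : pe_formula S n) (e : 'I_n -> A) :
  is_hom f -> sat phi e -> sat phi (f \o e).
Proof.
by move=> hf /sat_hom_on_finite[F _]; apply => r x _; apply: hf.
Qed.

Lemma is_hom_comp A B C (f : A -> B) (g : B -> C) :
  is_hom f -> is_hom g -> is_hom (g \o f).
Proof. by move=> hf hg r x /hf /hg. Qed.

Lemma hom_to_trans A B C : hom_to A B -> hom_to B C -> hom_to A C.
Proof. by move=> [f hf] [g hg]; exists (g \o f); apply: is_hom_comp. Qed.

Lemma embeds_hom_to A B : embeds_in A B -> hom_to A B.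
Proof. by move=> [f [_ hf]]; exists f => r x /hf. Qed.

Lemma pe_theory_hom_to A B : hom_to A B -> pe_theory A `<=` pe_theory B.
Proof.
move=> [f hf] phi /(sat_hom hf); rewrite /pe_theory /=.
by rewrite (env_ord0 (f \o _) (@empty_env B)).
Qed.

Definition induced A (F : set A) : structure S :=
  @Structure S {a : A | F a} (fun r x => rel_interp A r (sval \o x)).

Lemma induced_finite A (F : set A) : finite_set F -> finite_structure (induced F).
Proof.
move=> finF; rewrite /finite_structure.
have sval_inj : {in [set: induced F] &, injective (@sval A F)}.
  by move=> [a Fa] [b Fb] _ _ /= ab; apply: eq_exist.
rewrite -(eq_finite_set (inj_card_eq sval_inj)).
by apply: sub_finite_set finF => _ [[a Fa] _ <-].
Qed.

Lemma induced_embeds A (F : set A) : embeds_in (induced F) A.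
Proof.
exists (@sval A F); split=> // -[a Fa] [b Fb] /= ab.
exact: eq_exist.
Qed.

Lemma induced_Age A (F : set A) : finite_set F -> Age A (induced F).
Proof. by move=> /induced_finite finF; split=> //; apply: induced_embeds. Qed.

Lemma hom_to_Age A C : finite_structure C -> hom_to C A ->
  exists D, Age A D /\ hom_to C D.
Proof.
move=> finC [f hf]; exists (induced (range f)); split.
  exact/induced_Age/finite_image.
exists (fun c => exist _ (f c) (ex_intro2 _ _ c I erefl)) => r x /hf //.
Qed.

Lemma class_hom_to_Age A B : hom_to A B -> class_hom_to (Age A) (Age B).
Proof.
move=> AB C [finC /embeds_hom_to CA]; apply: hom_to_Age => //.
exact: hom_to_trans AB.
Qed.

Lemma CSP_class_hom_to A B : class_hom_to (Age A) (Age B) -> CSP A `<=` CSP B.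
Proof.
move=> AB C [finC /(hom_to_Age finC)[D [/AB[E [[_ EB] DE]] CD]]].
split=> //; apply: hom_to_trans CD _; apply: hom_to_trans DE _.
exact: embeds_hom_to.
Qed.

(** The substructure induced on [F] belongs to [CSP A], hence maps to [B]; composing with a
    retraction of [A] onto it makes the map total. *)
Lemma CSP_hom_on A B (F : set A) :
  CSP A `<=` CSP B -> finite_set F -> exists f : A -> B, is_hom_on F f.
Proof.
move=> AB.
have extend (G : set A) : finite_set G -> (A -> {a | G a}) ->
    exists f : A -> B, is_hom_on G f.
  move=> finG d; have [finI GA] := induced_Age finG.
  have [_ [f hf]] := AB (induced G) (conj finI (embeds_hom_to GA)).
  have /choice[p pP] (a : A) : exists q : {a | G a}, G a -> sval q = a.
    by have [Ga|nGa] := pselect (G a); [exists (exist _ a Ga)|exists (d a)].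
  exists (f \o p) => r x Gx rx; apply: (hf r (p \o x)).
  by rewrite /rel_interp /= (_ : _ \o _ = x)//; apply/funext => i; apply: pP.
(* The retraction needs a default value, so a point [a0] is added to [F]; over an empty [A] no value
   is ever requested. *)
have [[a0 _]|A0] := pselect (exists a : A, True); last first.
  by move=> finF; apply: extend => // a; case: A0; exists a.
move=> finF; have [||f hf] := extend (a0 |` F).
- by rewrite finite_setU; split=> //; apply: finite_set1.
- by move=> _; exists a0; left.
- by exists f; apply: is_hom_on_subset hf => a Fa; right.
Qed.

Lemma pe_theory_CSP A B : CSP A `<=` CSP B -> pe_theory A `<=` pe_theory B.
Proof.
move=> AB phi /sat_hom_on_finite[F finF satF].
have [f /satF] := CSP_hom_on AB finF.
by rewrite /pe_theory /= (env_ord0 (f \o _) (@empty_env B)).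
Qed.

End Homomorphisms.

Section Extension.
Context {S : signature}.
Implicit Types A B : structure S.

(** Each formula defines the relation of a singleton type, so the members of [Phi] define only
    finitely many relations; conjoining one member for each gives the required formula. *)
Lemma type_principal B n (Phi : set (pe_formula S n)) :
  weakly_oligomorphic B ->
  Phi (PEtrue S n) ->
  (forall phi psi, Phi phi -> Phi psi -> Phi (PEand phi psi)) ->
  exists2 phi, Phi phi &
    forall psi (b : 'I_n -> B), Phi psi -> sat phi b -> sat psi b.
Proof.
move=> woB PhiT PhiI.
have /(@finite_seqP {classic set ('I_n -> B)})[s sP] := woB n.
suff [phi Pphi phiP] : exists2 phi, Phi phi & forall psi, Phi psi ->
    (([set b : 'I_n -> B | sat psi b] : {classic set ('I_n -> B)}) \in s) ->
    [set b : 'I_n -> B | sat phi b] `<=` [set b | sat psi b].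
  exists phi => // psi b Ppsi; apply: phiP => //.
  have : [set` s] ([set b : 'I_n -> B | sat psi b] : {classic set ('I_n -> B)}).
    by rewrite -sP; exists [set psi]; rewrite /type_relation bigcap_set1.
  by [].
(* Start from [PEtrue] and conjoin a formula for [R] whenever some member of [Phi] defines [R]. *)
elim: s {sP} => [|R s [phi Pphi phiP]]; first by exists (PEtrue S n).
have [[psi [Ppsi psiR]]|nR] :=
  pselect (exists psi, Phi psi /\ [set b : 'I_n -> B | sat psi b] = R).
  exists (PEand phi psi); first exact: PhiI.
  move=> chi Pchi; rewrite in_cons => /orP[/eqP chiR|chis] b [satphi satpsi].
    by rewrite chiR -psiR.
  exact: phiP satphi.
exists phi => // chi Pchi; rewrite in_cons => /orP[/eqP chiR|]; last exact: phiP.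
by case: nR; exists chi.
Qed.

Lemma type_extension A B n (e : 'I_n -> A) (e' : 'I_n -> B) (a : A) :
  weakly_oligomorphic B ->
  (forall phi : pe_formula S n, sat phi e -> sat phi e') ->
  exists b : B, forall phi : pe_formula S n.+1,
    sat phi (env_cons a e) -> sat phi (env_cons b e').
Proof.
move=> woB ee'.
have [] := @type_principal B n.+1 [set phi | sat phi (env_cons a e)] woB.
- by [].
- by move=> phi psi; split.
- move=> phi phia phiP; have [b bphi] : sat (PEex phi) e'.
    by apply: ee'; exists a.
  by exists b => psi psia; apply: phiP bphi.
Qed.

(** The list is the graph of a finite partial map; preservation of [PEeq] makes it single-valued. *)
Definition pe_preserving A B (s : seq (A * B)) : Prop :=
  forall phi : pe_formula S (size s),
    sat phi (fst \o tnth (in_tuple s)) -> sat phi (snd \o tnth (in_tuple s)).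

Definition occurs (T : Type) (s : seq T) : set T := range (tnth (in_tuple s)).

Lemma tnth_in_tuple_cons (T : Type) (x : T) (s : seq T) :
  tnth (in_tuple (x :: s)) = env_cons x (tnth (in_tuple s)).
Proof.
apply/funext => i; rewrite /env_cons; case: unliftP => [j|] -> /=.
  by rewrite !(tnth_nth x).
by rewrite (tnth_nth x).
Qed.

Lemma occurs_cons (T : Type) (x : T) (s : seq T) :
  occurs (x :: s) = x |` occurs s.
Proof.
rewrite /occurs tnth_in_tuple_cons; apply/seteqP; split=> y /=.
  by move=> [i _ <-]; rewrite /env_cons; case: unlift => [j|]; [right; exists j|left].
move=> [->|[j _ <-]]; first by exists ord0; rewrite // /env_cons unlift_none.
by exists (lift ord0 j); rewrite // /env_cons liftK.
Qed.

(** Preservation is assumed inside the conclusions, so that choice yields a step function on all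
    lists. [None] covers the gaps of an enumeration. *)
Lemma pe_preserving_extend A B (s : seq (A * B)) (o : option A) :
  weakly_oligomorphic B -> exists s',
  [/\ pe_preserving s -> pe_preserving s',
      occurs s `<=` occurs s' &
      pe_preserving s -> forall a, o = Some a -> exists b, occurs s' (a, b)].
Proof.
move=> woB; case: o => [a|]; last by exists s; split.
have [sP|nsP] := pselect (pe_preserving s); last by exists s; split.
have [b bP] := type_extension a woB sP; exists ((a, b) :: s).
rewrite occurs_cons; split=> [_||_ _ [<-]]; last by exists b; left.
  by rewrite /pe_preserving tnth_in_tuple_cons !comp_env_cons.
by move=> p; right.
Qed.

Lemma countable_enum (T : Type) : countable [set: T] ->
  exists o : nat -> option T, forall a, exists n, o n = Some a.
Proof.
move=> /countable_injP[f finj].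
have /choice[o oP] (n : nat) : exists o : option T, forall a, f a = n -> o = Some a.
  have [[a <-]|nf] := pselect (exists a, f a = n).
    by exists (Some a) => b fba; congr Some; apply: finj; rewrite ?inE.
  by exists None => a fa; case: nf; exists a.
by exists o => a; exists (f a); apply: oP.
Qed.

Lemma hom_to_pe_theory A B : countable_structure A -> weakly_oligomorphic B ->
  pe_theory A `<=` pe_theory B -> hom_to A B.
Proof.
move=> /countable_enum[o oP] woB AB.
have [g gP] := choice (fun p => @pe_preserving_extend A B p.2 (o p.1) woB).
pose s := fix s n := if n is m.+1 then g (m, s m) else [::].
have s_pe n : pe_preserving (s n).
  elim: n => [|n IHn] /=; last by have [+ _ _] := gP (n, s n); apply.
  (* For the empty list the formulas are sentences, and preservation is the inclusion of the
     theories. *)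
  move=> phi; rewrite (env_ord0 (fst \o _) (@empty_env A)).
  by rewrite (env_ord0 (snd \o _) (@empty_env B)); apply: AB.
have s_mono m n : m <= n -> occurs (s m) `<=` occurs (s n).
  move=> /subnK <-; elim: (n - m) => [|k IHk] // p /IHk.
  by have [_ + _] := gP (k + m, s (k + m)); apply.
have /choice[f fP] a : exists b, exists n, occurs (s n) (a, b).
  have [n on] := oP a; have [_ _ /(_ (s_pe n) a on)[b ab]] := gP (n, s n).
  by exists b, n.+1.
have [N NP] := choice fP.
exists f => r x rx.
(* By stage [M] all pairs [(x i, f (x i))] have occurred; [v] gives their positions, and
   preservation of the atom [PErel v] concludes. *)
pose M := \max_(i < arity r) N (x i).
have /choice[v vP] i : exists j, tnth (in_tuple (s M)) j = (x i, f (x i)).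
  have le_NM : N (x i) <= M by exact: (@leq_bigmax _ (fun i => N (x i)) i).
  by have [j _ jP] := s_mono _ _ le_NM _ (NP (x i)); exists j.
have := s_pe M (PErel v) => /=.
rewrite (_ : _ \o v = x); last by apply/funext => i /=; rewrite vP.
rewrite (_ : _ \o v = f \o x); last by apply/funext => i /=; rewrite vP.
exact.
Qed.

End Extension.

Theorem mainTheorem17 (S : signature) (A B : structure S)
    (cA : countable_structure A) (cB : countable_structure B)
    (woA : weakly_oligomorphic A) (woB : weakly_oligomorphic B) :
  [<-> hom_equivalent A B;
       pe_theory A = pe_theory B;
       class_hom_to (Age A) (Age B) /\ class_hom_to (Age B) (Age A);
       CSP A = CSP B].
Proof.
(* Stated separately because it serves two legs of the cycle: from theories to ages, and from [CSP]
   back to homomorphisms. *)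
have theory_hom : pe_theory A = pe_theory B -> hom_equivalent A B.
  by move=> AB; split; apply: hom_to_pe_theory => //; rewrite AB.
tfae.
- by move=> [AB BA]; apply/seteqP; split; apply: pe_theory_hom_to.
- by move=> /theory_hom[AB BA]; split; apply: class_hom_to_Age.
- by move=> [AB BA]; apply/seteqP; split; apply: CSP_class_hom_to.
- by move=> AB; apply: theory_hom; apply/seteqP; split; apply: pe_theory_CSP; rewrite AB.
Qed.
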